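(* As $k\to\infty$, $$1-\max_{0\le a\le k-1}d_{k,a}=O(k^{-1/2}),$$ whereas $$d_k\longrightarrow 1-\frac{e^{-1/2}}{2}.$$
   Context: For an integer $k\ge 3$, define $$d_k:=1-\frac{k-1}{2k}\left(1-\frac{1}{2k}\right)^{k-2}.$$ For $k\ge 3$ and an integer $a\in\{0,\ldots,k-1\}$, let $X_{k,a}\sim\operatorname{Bin}\left(k-1,\frac{2a+1}{2k}\right)$ be a binomial random variable, with $\mathbb{P}(X_{k,a}=j)=0$ for $j\notin\{0,\ldots,k-1\}$, and define $$d_{k,a}:=1-\max\bigl\{\mathbb{P}\bigl(X_{k,a}\in\{a-1,a+2\}\bigr),\ \mathbb{P}\bigl(X_{k,a}\in\{a-2,a+1\}\bigr)\bigr\}.$$ The maximum in the claim is over integers $a$. *)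

(* Defs.v *)
From HB Require Import structures.
From mathcomp Require Import all_boot all_order all_algebra.
From mathcomp Require Import all_classical all_reals all_analysis.
Set Implicit Arguments.
Unset Strict Implicit.
Unset Printing Implicit Defensive.
Import Order.TTheory GRing.Theory Num.Theory.
Import numFieldNormedType.Exports.
Local Open Scope classical_set_scope.
Local Open Scope ring_scope.

(* The functions below are total in [k], but only their values at [3 <= k]
   (and [a < k]) are meaningful. *)

Definition d {R : realType} (k : nat) : R :=
  1 - (k%:R - 1) / (2 * k%:R) * (1 - 1 / (2 * k%:R)) ^+ (k - 2).

(* P(X_{k,a} \in S). The library's binomial law lives on [nat], while [a - 1]
   and [a - 2] may be negative, hence the set of integers [S]. For [a < k] the
   success parameter lies in ]0, 1[, so [binomial_prob] is the binomial law
   and not its default value. *)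
Definition Xprob {R : realType} (k a : nat) (S : set int) : R :=
  fine (binomial_prob (k - 1) ((2 * a%:R + 1) / (2 * k%:R) : R)
          (Posz @^-1` S)).

Definition da {R : realType} (k a : nat) : R :=
  1 - Num.max (Xprob k a [set a%:Z - 1; a%:Z + 2])
              (Xprob k a [set a%:Z - 2; a%:Z + 1]).

(* The maximum over [0 <= a <= k - 1]; the default value [da k 0] is itself
   one of the terms when [0 < k]. *)
Definition max_da {R : realType} (k : nat) : R :=
  \big[Num.max/da k 0]_(a < k) da k a.

(* Main.v *)
Require Import Defs.
From HB Require Import structures.
From mathcomp Require Import all_boot all_order all_algebra.
From mathcomp Require Import all_classical all_reals all_analysis.
From mathcomp Require Import zify ring lra.
Import Order.TTheory GRing.Theory Num.Theory.
Import numFieldNormedType.Exports.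
Local Open Scope classical_set_scope.
Local Open Scope ring_scope.

(** Both claims follow from explicit inequalities between elementary functions.

    For the first, it suffices to exhibit one index [a] at which [da k a] is
    close to [1], and the central one, [a = k./2], will do: the success
    parameter is then within [1 / (2 k)] of [1 / 2], so every point mass is at
    most [(1 + 1/k)^(k-1)] times the corresponding mass of the symmetric
    binomial law on [k - 1] trials. The first factor is at most [e], and the
    second is at most [1 / sqrt k] because a binomial coefficient satisfies
    ['C(n, m) ^ 2 * (n + 1) <= 4 ^ n] ([leq_sqr_bin]). Hence all point masses
    are at most [e / sqrt k] ([binomial_pmf_near_half]); the events in the
    definition of [da] contain at most two points, so they have probability at
    most [2 e / sqrt k] ([Xprob_half_le]). In the other direction, no [da k a]
    exceeds [1], so that [1 - max_da k] is nonnegative and bounding it from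
    above bounds its absolute value.

    For the second, the only factor of the subtracted term of [d k] that is
    not a fixed rational function of [k] is a power [(1 - x)^m] with
    [x --> 0] and [m * x --> 1 / 2]; such powers converge to
    [expR (- (1 / 2))] ([cvg_expr1B]), since the convexity bound
    [1 + y <= expR y] encloses them between two exponentials. *)

(** * Size of binomial coefficients *)

Lemma leq_binS_half n m : (n <= m.*2.+1)%N -> ('C(n, m.+1) <= 'C(n, m))%N.
Proof.
move=> nm; rewrite -(leq_pmul2l (ltn0Sn m)) mul_bin_left leq_mul2r.
by apply/orP; right; lia.
Qed.

(** The coefficients decrease from [uphalf n] on, and the symmetry of the row
    carries the left half onto the right half. *)
Lemma leq_bin_half n m : ('C(n, m) <= 'C(n, n./2))%N.
Proof.
have nhalf : (n./2 + uphalf n = n)%N by rewrite uphalf_half; lia.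
have down i : ('C(n, uphalf n + i) <= 'C(n, n./2))%N.
  elim: i => [|i IHi].
    rewrite addn0 -(@bin_sub n n./2); last by lia.
    by rewrite (_ : n - n./2 = uphalf n)%N//; lia.
  apply: leq_trans IHi; rewrite addnS; apply: leq_binS_half.
  by have := odd_double_half n; rewrite uphalf_half; lia.
have [mn|mn] := leqP (uphalf n) m; first by rewrite -(subnKC mn).
have mn' : (m <= n)%N by lia.
have -> // : ('C(n, m) = 'C(n, uphalf n + (n./2 - m)))%N.
rewrite -(bin_sub mn'); congr 'C(_, _).
by move: nhalf mn; rewrite uphalf_half; lia.
Qed.

(** From [m] to [m + 1] the central coefficient is multiplied by
    [2 (2m+1) / (m+1)]; so the left-hand side is multiplied by
    [4 (2m+1) (2m+3) / (m+1)^2], which is less than [16]. The factor [2m+1] is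
    what makes the induction close. *)
Lemma leq_sqr_bin_center m : ('C(m.*2, m) ^ 2 * m.*2.+1 <= 16 ^ m)%N.
Proof.
elim: m => [|m IHm]; first by rewrite bin0.
(* Two absorption identities, joined by the symmetry of the row 2m+1. *)
have step : (m.+1 * 'C(m.+1.*2, m.+1) = 2 * m.*2.+1 * 'C(m.*2, m))%N.
  have E1 := mul_bin_diag m.+1.*2 m.
  have E2 := mul_bin_diag m.*2.+1 m.
  have E3 : 'C(m.*2.+1, m.+1) = 'C(m.*2.+1, m).
    rewrite -(@bin_sub m.*2.+1 m); last by lia.
    by congr 'C(_, _); lia.
  rewrite doubleS/= in E1 *; rewrite /= in E2.
  by move: E1 E2; rewrite E3 -mul2n; nia.
rewrite -(@leq_pmul2l (m.+1 ^ 2)) ?expn_gt0// mulnA -expnMn step.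
rewrite (expnS 16); move: ('C(m.*2, m)) IHm => c IHm; move: (16 ^ m)%N IHm => s IHm.
apply: (@leq_trans (4 * m.*2.+1 * m.*2.+3 * (c ^ 2 * m.*2.+1))).
  by rewrite doubleS -mul2n; lia.
apply: (@leq_trans (4 * m.*2.+1 * m.*2.+3 * s)).
  by rewrite leq_mul2l IHm orbT.
by rewrite mulnA leq_mul2r; apply/orP; right; rewrite -mul2n; lia.
Qed.

(** An odd row [2h+1] is compared to the even row [2h+2], whose central entry
    is the sum of the two equal middle entries of the odd row. *)
Lemma leq_sqr_bin n m : ('C(n, m) ^ 2 * n.+1 <= 4 ^ n)%N.
Proof.
apply: (@leq_trans ('C(n, n./2) ^ 2 * n.+1)).
  by rewrite leq_mul2r leq_exp2r// leq_bin_half orbT.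
have := leq_sqr_bin_center (uphalf n).
rewrite -[16%N]/(4 ^ 2)%N -expnM mul2n uphalf_half.
have [no|ne] := boolP (odd n); last first.
  by rewrite add0n even_halfK.
have nE : n = n./2.*2.+1 by rewrite odd_halfK// prednK// odd_gt0.
move: (n./2) nE => h -> /=.
have E : 'C((1 + h).*2, 1 + h) = (2 * 'C(h.*2.+1, h))%N.
  rewrite add1n doubleS binS mul2n -[RHS]addnn; congr (_ + _)%N.
  by rewrite -(@bin_sub h.*2.+1 h); [congr 'C(_, _); lia | lia].
rewrite E add1n doubleS expnS => H.
rewrite -(@leq_pmul2l 4)//; apply: leq_trans H.
by move: ('C(_, _)) => c; rewrite !expnS expn0; nia.
Qed.

Lemma bin_le_sqrt {R : realType} n m :
  ('C(n, m))%:R <= 2 ^+ n / Num.sqrt n.+1%:R :> R.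
Proof.
have s0 : 0 < Num.sqrt n.+1%:R :> R by rewrite sqrtr_gt0 ltr0n.
rewrite ler_pdivlMr// -(@ler_pXn2r _ 2) ?nnegrE ?mulr_ge0 ?exprn_ge0 ?(ltW s0)//.
rewrite exprMn sqr_sqrtr ?ler0n// -!natrX -natrM ler_nat.
by rewrite -expnM (mulnC n) expnM leq_sqr_bin.
Qed.

(** * Point masses of a nearly symmetric binomial law *)

Lemma binomial_pmf_le {R : realType} n (p q : R) j :
  0 <= p <= 1 -> p <= q -> 1 - p <= q ->
  binomial_pmf n p j <= q ^+ n *+ 'C(n, j).
Proof.
move=> /andP[p0 p1] pq p'q; rewrite /binomial_pmf lerMn2r.
have [jn|/bin_small->//] := leqP j n; apply/orP; right.
have q0 : 0 <= q := le_trans p0 pq.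
rewrite -{2}(subnKC jn) exprD ler_pM ?exprn_ge0 ?subr_ge0//.
- by rewrite lerXn2r ?nnegrE.
- by rewrite lerXn2r ?nnegrE ?subr_ge0.
Qed.

(** A deviation of [1 / (2 (n+1))] from [1 / 2] is small enough to cost only a
    bounded factor: both [p] and [1 - p] are at most [(1 + 1/(n+1)) / 2], and
    [(1 + 1/(n+1))^n <= e]. *)
Lemma binomial_pmf_near_half {R : realType} n (p : R) j :
  `|p - 2^-1| <= (2 * n.+1%:R)^-1 ->
  binomial_pmf n p j <= expR 1 / Num.sqrt n.+1%:R.
Proof.
set k : R := n.+1%:R; have k1 : 1 <= k by rewrite ler1n.
rewrite invfM ler_distl => /andP[pl pu].
have /andP[ki0 ki1] : 0 < k^-1 <= 1.
  by rewrite invr_gt0 invf_le1 ?(lt_le_trans ltr01).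
apply: (le_trans (@binomial_pmf_le R n p ((1 + k^-1) / 2) j _ _ _)).
- by move: (k^-1) pl pu ki0 ki1 => i *; apply/andP; split; lra.
- by move: (k^-1) pu => i *; lra.
- by move: (k^-1) pl => i *; lra.
rewrite -mulr_natr exprMn.
have -> : expR 1 / Num.sqrt k = expR 1 * 2^-1 ^+ n * (2 ^+ n / Num.sqrt k) :> R.
  by rewrite -!mulrA [_ ^+ n * (_ * _)]mulrA -exprMn mulVf// expr1n mul1r.
have ki_ge0 := ltW ki0.
rewrite ler_pM ?mulr_ge0 ?exprn_ge0 ?addr_ge0 ?bin_le_sqrt//.
rewrite ler_pM2r ?exprn_gt0//.
have -> : expR 1 = expR k^-1 ^+ n.+1 :> R.
  by rewrite -expRM_natl mulfV ?gt_eqF// (lt_le_trans ltr01).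
apply: (@le_trans _ _ (expR k^-1 ^+ n)).
  by rewrite lerXn2r ?nnegrE ?expR_ge0 ?expR_ge1Dx ?addr_ge0.
by rewrite exprS ler_peMl ?exprn_ge0 ?expR_ge0// -expR0 ler_expR.
Qed.

(** A negative [x] has an empty preimage; this is how the out-of-range values
    [a - 1] and [a - 2] contribute nothing. *)
Lemma binomial_prob1 {R : realType} n (p : R) (x : int) (M : R) :
  0 <= p <= 1 -> 0 <= M -> (forall j, binomial_pmf n p j <= M) ->
  (binomial_prob n p (Posz @^-1` [set x]) <= M%:E)%E.
Proof.
move=> p01 M0 pM; case: x => j.
  rewrite (_ : _ @^-1` _ = [set j]); last first.
    by apply/seteqP; split => i /=; [case|move->].
  by rewrite /binomial_prob p01 esum_set1 ?lee_fin ?binomial_pmf_ge0.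
rewrite (_ : _ @^-1` _ = set0) ?measure0 ?lee_fin//.
by apply/seteqP; split => i.
Qed.

Lemma binomial_prob2 {R : realType} n (p : R) (x y : int) (M : R) :
  0 <= p <= 1 -> (forall j, binomial_pmf n p j <= M) ->
  fine (binomial_prob n p (Posz @^-1` [set x; y])) <= 2 * M.
Proof.
move=> p01 pM; have M0 : 0 <= M by apply: le_trans (pM 0); exact: binomial_pmf_ge0.
rewrite -lee_fin fineK ?fin_num_measure// preimage_setU.
rewrite (le_trans (measureU2 _ _ _))// mulr_natl mulr2n EFinD leeD//;
  exact: binomial_prob1.
Qed.

(** * The central index *)

Lemma Xprob_ge0 {R : realType} k a S : 0 <= Xprob k a S :> R.
Proof. by rewrite /Xprob fine_ge0. Qed.

Lemma Xprob_half_le {R : realType} k x y : (0 < k)%N ->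
  Xprob k k./2 [set x; y] <= 2 * (expR 1 / Num.sqrt k%:R) :> R.
Proof.
case: k => // n _; rewrite /Xprob subn1/=.
set p : R := _ / _.
have pD : `|p - 2^-1| <= (2 * n.+1%:R)^-1.
  (* With a = k./2, the numerator 2a + 1 - k is 0 for odd k and 1 for even k. *)
  have -> : p - 2^-1 = (2 * (n.+1./2)%:R + 1 - n.+1%:R) * (2 * n.+1%:R)^-1.
    have : n.+1%:R != 0 :> R by rewrite pnatr_eq0.
    by rewrite /p; move: n.+1%:R => k k0; field.
  rewrite normrM [X in _ * X]ger0_norm ?invr_ge0// ler_piMl ?invr_ge0//.
  have : n.+1%:R = (odd n.+1)%:R + 2 * (n.+1./2)%:R :> R.
    by rewrite -natrM -natrD mul2n odd_double_half.
  move: (odd n.+1) => b ->; rewrite ler_norml.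
  by case: b => /=; lra.
apply: binomial_prob2 => [|j]; last exact: binomial_pmf_near_half.
have : (n.+1%:R)^-1 <= 1 :> R by rewrite invf_le1// ler1n.
move: pD; rewrite invfM ler_distl; move: p (n.+1%:R^-1) => q i.
by move=> /andP[? ?] ?; apply/andP; split; lra.
Qed.

Lemma max_da_le1 {R : realType} k : max_da k <= 1 :> R.
Proof.
have da1 a : da k a <= 1 :> R.
  by rewrite /da gerBl le_max Xprob_ge0.
by apply: bigmax_le.
Qed.

Lemma onem_max_da_le {R : realType} k : (0 < k)%N ->
  1 - max_da k <= 2 * (expR 1 / Num.sqrt k%:R) :> R.
Proof.
move=> k0; have hk : (k./2 < k)%N by rewrite ltn_half_double; lia.
rewrite lerBlDl -lerBlDr.
apply: le_trans (le_bigmax _ _ (Ordinal hk)).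
by rewrite /da lerD2l lerN2 ge_max !Xprob_half_le.
Qed.

(** * Powers converging to an exponential *)

Lemma expr1B_le_expR {R : realType} (x : R) m : x <= 1 ->
  (1 - x) ^+ m <= expR (- (m%:R * x)).
Proof.
move=> x1; rewrite -mulrN expRM_natl lerXn2r ?nnegrE ?subr_ge0 ?expR_ge0//.
exact: expR_ge1Dx.
Qed.

(** Reciprocal form of [1 + y <= expR y], at [y = x / (1 - x)], for which
    [1 + y] is the inverse of [1 - x]. *)
Lemma expr1B_ge_expR {R : realType} (x : R) m : x < 1 ->
  expR (- (m%:R * x / (1 - x))) <= (1 - x) ^+ m.
Proof.
move=> x1; have y0 : 0 < 1 - x by rewrite subr_gt0.
rewrite -mulrA -mulrN expRM_natl lerXn2r ?nnegrE ?expR_ge0 ?(ltW y0)//.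
rewrite expRN invf_ple ?posrE ?expR_gt0//.
apply: le_trans (expR_ge1Dx _).
by rewrite le_eqVlt; apply/orP; left; apply/eqP; field; rewrite gt_eqF.
Qed.

Lemma cvg_expr1B {R : realType} (x : nat -> R) (m : nat -> nat) (l : R) :
  x @ \oo --> 0 -> (m k)%:R * x k @[k --> \oo] --> l ->
  (1 - x k) ^+ m k @[k --> \oo] --> expR (- l).
Proof.
move=> x0 mxl.
apply: (@squeeze_cvgr _ _ _ _ (fun k => expR (- ((m k)%:R * x k / (1 - x k))))
  (fun k => expR (- ((m k)%:R * x k)))).
- have : \forall k \near \oo, x k < 1 by apply: (cvgr_lt 0).
  apply: filterS => k xk1.
  by rewrite expr1B_ge_expR// expr1B_le_expR// ltW.
- apply: continuous_cvg; first exact: continuous_expR.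
  apply: cvgN; rewrite -[X in _ --> X]mulr1; apply: cvgM => //.
  rewrite -[X in _ --> X]invr1; apply: cvgV; first exact: oner_neq0.
  by rewrite -[X in _ --> X]subr0; apply: cvgB => //; exact: cvg_cst.
- apply: continuous_cvg; first exact: continuous_expR.
  exact: cvgN.
Qed.

(** * Limit of [d] *)

Lemma cvg_invn {R : realType} : (k%:R^-1 : R) @[k --> \oo] --> (0 : R).
Proof. by rewrite -cvg_shiftS; exact: cvg_harmonic. Qed.

Lemma cvg_d {R : realType} :
  (d k : R) @[k --> \oo] --> 1 - expR (- (1 / 2)) / 2.
Proof.
have x0 : 1 / (2 * k%:R) @[k --> \oo] --> (0 : R).
  have -> : (fun k => 1 / (2 * k%:R)) = (fun k => 2^-1 * k%:R^-1) :> (nat -> R).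
    by apply/funext => k; rewrite mul1r invfM.
  by rewrite -[X in _ --> X](mulr0 2^-1); apply: cvgM; [exact: cvg_cst|exact: cvg_invn].
(* Both (k-1)/(2k) and (k-2)/(2k) have this form, with c = 1/2 and c = 1. *)
have half c : (2^-1 - c * k%:R^-1 : R) @[k --> \oo] --> (2^-1 : R).
  rewrite -[X in _ --> X]subr0 -(mulr0 c).
  apply: cvgB; first exact: cvg_cst.
  by apply: cvgM; [exact: cvg_cst|exact: cvg_invn].
apply: cvgB; first exact: cvg_cst.
rewrite mul1r mulrC; apply: cvgM.
  apply: cvg_trans (half 2^-1); apply: near_eq_cvg.
  near=> k; have k0 : k%:R != 0 :> R.
    by rewrite pnatr_eq0 -lt0n; near: k; exact: nbhs_infty_gt.
  by field.
apply: cvg_expr1B => //.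
apply: cvg_trans (half 1); apply: near_eq_cvg.
near=> k; have k2 : (1 < k)%N by near: k; exact: nbhs_infty_gt.
rewrite natrB//; field.
by rewrite pnatr_eq0; lia.
Unshelve. all: by end_near.
Qed.

Theorem corollary1p4 (R : realType) :
  ((fun k : nat => 1 - max_da k : R)
     =O_\oo (fun k : nat => (k%:R : R) `^ (- (1 / 2)))) /\
  (d k : R) @[k --> \oo] --> 1 - expR (- (1 / 2)) / 2.
Proof.
split; last exact: cvg_d.
apply/eqO_exP; exists (2 * expR 1); first by rewrite mulr_gt0 ?expR_gt0.
near=> k.
rewrite ger0_norm ?subr_ge0 ?max_da_le1// ger0_norm ?powR_ge0//.
rewrite powRN mul1r powR12_sqrt// -mulrA onem_max_da_le//.
by near: k; exact: nbhs_infty_gt.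
Unshelve. all: by end_near.
Qed.
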